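(* Let $A$ be a (possibly non-unital) $\subseteq_\perp$-Blackadar $*$-ring. Then maximal lower bounds in $\mathcal{P}$ are $\ll$-infimums in $A$: if $Q\subseteq\mathcal{P}$ and $p\in\mathcal{P}$ is maximal with respect to $\ll$ among the elements $p'\in\mathcal{P}$ satisfying $p'\ll q$ for all $q\in Q$, then $$\{a\in A:a\ll p\}=\bigcap_{q\in Q}\{a\in A:a\ll q\}.$$
   Context: A $*$-ring is an associative ring with a map $a\mapsto a^*$ satisfying $a^{**}=a$, $(ab)^*=b^*a^*$, $(a+b)^*=a^*+b^*$. $\mathcal{P}=\{p\in A:p=pp^*\}$ is the set of projections. The relation $\ll$ on $A$ is $a\ll b\Leftrightarrow a=ab$; it is a partial order on $\mathcal{P}$. The relation $\subseteq_\perp$ on $A$ is: $a\subseteq_\perp b\Leftrightarrow$ for all $x\in A$, $bx=0$ implies $ax=0$. $A$ is $\subseteq_\perp$-Blackadar if for every $a\in A\setminus\{0\}$ there is $p\in\mathcal{P}\setminus\{0\}$ with $p\subseteq_\perp a$. An intersection over the empty index set is $A$. *)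

(* Defs.v *)
From HB Require Import structures.
From mathcomp Require Import all_boot all_algebra.
From mathcomp Require Import classical_sets.

Set Implicit Arguments.
Unset Strict Implicit.
Unset Printing Implicit Defensive.

Import GRing.Theory.

Local Open Scope classical_set_scope.
Local Open Scope ring_scope.

(* MathComp's rings all have a unit.  A possibly non-unital ring is encoded as
   an additive group ([zmodType]) that is also a multiplicative [semigroupType],
   with distributivity on both sides.  Below, [x * y] is the semigroup product,
   not the product of a unital ring. *)
Local Notation "x * y" := (monoid.mul x y) : ring_scope.

HB.mixin Record Zmodule_Semigroup_isStarRing A
    of GRing.Zmodule A & Semigroup A := {
  smulDl : forall a b c : A, (a + b) * c = a * c + b * c;
  smulDr : forall a b c : A, a * (b + c) = a * b + a * c;
  star : A -> A;
  starK : forall a : A, star (star a) = a;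
  starM : forall a b : A, star (a * b) = star b * star a;
  starD : forall a b : A, star (a + b) = star a + star b
}.

#[short(type="starRingType")]
HB.structure Definition StarRing :=
  { A of Zmodule_Semigroup_isStarRing A & GRing.Zmodule A & Semigroup A }.

Section StarRingDefs.

Variable A : starRingType.

Definition Proj : set A := [set p | p = p * star p].

Definition ll (a b : A) : Prop := a = a * b.

Definition subperp (a b : A) : Prop := forall x : A, b * x = 0 -> a * x = 0.

Definition Blackadar (R : A -> A -> Prop) : Prop :=
  forall a : A, a <> 0 -> exists2 p : A, Proj p /\ p <> 0 & R p a.

Definition proj_lower_bounds (Q : set A) : set A :=
  [set p | Proj p /\ forall q : A, Q q -> ll p q].

Definition maximal_in (R : A -> A -> Prop) (S : set A) (p : A) : Prop :=
  S p /\ forall p' : A, S p' -> R p p' -> p' = p.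

End StarRingDefs.

(* Main.v *)
Require Import Defs.
From mathcomp Require Import all_boot all_algebra.
From mathcomp Require Import classical_sets.
From mathcomp Require Import boolp.

Local Open Scope classical_set_scope.

(** That [p] is a lower bound gives one inclusion by transitivity of [ll].  For
    the other, let [a] satisfy [ll a q] for all [q] in [Q] and suppose that
    [b := a - a * p] is nonzero.  Then [b * q = b] for all [q] in [Q] and
    [b * p = 0].  The Blackadar property gives a nonzero projection [r] with
    [subperp r b], and both relations pass from [b] to [r]: the second one by
    definition, the first one by [subperp_ll].  So [r] is a lower bound of [Q]
    orthogonal to [p], hence [p + r] is a projection below [Q] and above [p],
    and maximality of [p] forces [r = 0], a contradiction.

    Without a unit, [b * q = b] only says that [b] kills [q * x - x] for every
    [x], so what transfers is [(r * q - r) * x = 0] for all [x].  The Blackadar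
    property is used a second time to conclude [r * q = r], as it excludes
    nonzero left annihilators of the whole ring
    ([Blackadar_left_faithful]). *)

Import GRing.Theory.
Local Open Scope ring_scope.
Local Notation "x * y" := (monoid.mul x y) : ring_scope.

Section StarRingTheory.

Set Implicit Arguments.
Unset Strict Implicit.

Variable A : starRingType.
Implicit Types a b c p q r x : A.

Lemma smul0r a : 0 * a = 0.
Proof. by apply: (addrI (0 * a)); rewrite -smulDl !addr0. Qed.

Lemma smulr0 a : a * 0 = 0.
Proof. by apply: (addrI (a * 0)); rewrite -smulDr !addr0. Qed.

Lemma smulNr a b : (- a) * b = - (a * b).
Proof. by apply: (addrI (a * b)); rewrite -smulDl !subrr smul0r. Qed.

Lemma smulrN a b : a * (- b) = - (a * b).
Proof. by apply: (addrI (a * b)); rewrite -smulDr !subrr smulr0. Qed.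

Lemma smulBl a b c : (a - b) * c = a * c - b * c.
Proof. by rewrite smulDl smulNr. Qed.

Lemma smulBr a b c : a * (b - c) = a * b - a * c.
Proof. by rewrite smulDr smulrN. Qed.

Lemma star0 : star (0 : A) = 0.
Proof. by apply: (addrI (star 0)); rewrite -starD !addr0. Qed.

Lemma Proj_star p : Proj p -> star p = p.
Proof. by move=> pE; rewrite [in LHS]pE starM starK -pE. Qed.

Lemma Proj_idem p : Proj p -> p * p = p.
Proof. by move=> Pp; rewrite -{2}(Proj_star Pp). Qed.

Lemma ll_trans a b c : ll a b -> ll b c -> ll a c.
Proof. by rewrite /ll => ab bc; rewrite {2}ab -monoid.mulgA -bc. Qed.

Lemma Proj_orthC p q : Proj p -> Proj q -> p * q = 0 -> q * p = 0.
Proof.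
by move=> Pp Pq pq0; rewrite -(Proj_star Pp) -(Proj_star Pq) -starM pq0 star0.
Qed.

Lemma ProjD p q : Proj p -> Proj q -> p * q = 0 -> Proj (p + q).
Proof.
move=> Pp Pq pq0; rewrite /Proj /= starD !Proj_star // smulDl !smulDr.
by rewrite pq0 (Proj_orthC Pp Pq pq0) !Proj_idem // addr0 add0r.
Qed.

(** A nonzero projection [s] with [subperp s c] would annihilate whatever [c]
    annihilates, in particular [s] itself, whereas [s * s = s]. *)
Lemma Blackadar_left_faithful c :
  Blackadar (@subperp A) -> (forall x, c * x = 0) -> c = 0.
Proof.
move=> hA c0; apply: contrapT => /hA[s [Ps s0] sc].
by apply: s0; rewrite -(Proj_idem Ps); apply: sc.
Qed.

(** In a unital ring, applying [subperp a b] to [q - 1] would be enough; here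
    [q * x - x] stands in for [(q - 1) * x]. *)
Lemma subperp_ll a b q :
  Blackadar (@subperp A) -> subperp a b -> ll b q -> ll a q.
Proof.
move=> hA ab bq; apply/esym/subr0_eq/(Blackadar_left_faithful hA) => x.
rewrite smulBl -monoid.mulgA -smulBr; apply: ab.
by rewrite smulBr monoid.mulgA -bq subrr.
Qed.

End StarRingTheory.

Theorem proposition4 (A : starRingType) (hA : Blackadar (@subperp A))
    (Q : set A) (hQ : Q `<=` @Proj A)
    (p : A) (hp : maximal_in (@ll A) (proj_lower_bounds Q) p) :
  [set a : A | ll a p] = \bigcap_(q in Q) [set a : A | ll a q].
Proof.
case: hp => -[Pp pQ] pmax; apply/seteqP; split=> a /= aP.
  by move=> q /pQ; apply: ll_trans.
apply: contrapT => nap.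
have b0 : a - a * p <> 0 by move/subr0_eq.
have [r [Pr r0] rb] := hA _ b0.
have bQ q : Q q -> ll (a - a * p) q.
  by move=> Qq; rewrite /ll smulBl -monoid.mulgA -(pQ _ Qq) -(aP _ Qq).
have rp0 : r * p = 0.
  by apply: rb; rewrite smulBl -monoid.mulgA Proj_idem // subrr.
have pr0 := Proj_orthC Pr Pp rp0.
have lbD : proj_lower_bounds Q (p + r).
  split; first exact: ProjD.
  move=> q Qq; rewrite /ll smulDl -(pQ _ Qq).
  by rewrite -(subperp_ll hA rb (bQ _ Qq)).
apply: r0; apply: (addrI p); rewrite addr0; apply: pmax lbD _.
by rewrite /ll smulDr pr0 addr0 Proj_idem.
Qed.
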